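(* Let $N$ be a negative translation into $\mathsf{IL}$. The following are equivalent: (1) $N$ is equivalent in $\mathsf{IL}$ to the Gödel–Gentzen translation, i.e. $\mathsf{IL} \vdash N(A) \leftrightarrow A^G$ for all formulas $A$; (2) $N$ translates into $\mathsf{NF}$ in $\mathsf{IL}$, i.e. for every formula $A$ there is $B \in \mathsf{NF}$ with $\mathsf{IL} \vdash N(A) \leftrightarrow B$; (3) $N$ acts as the identity on $\mathsf{NF}$ in $\mathsf{IL}$, i.e. $\mathsf{IL} \vdash N(A) \leftrightarrow A$ for all $A \in \mathsf{NF}$. The same holds with $\mathsf{ML}$ in place of $\mathsf{IL}$ throughout (for $N$ a negative translation into $\mathsf{ML}$, and equivalences provable in $\mathsf{ML}$).
   Context: $\mathsf{CL}$ is pure first-order classical predicate logic based on $\bot, \wedge, \vee, \to, \forall, \exists$ (with $\neg A :\equiv A\to\bot$, $A\leftrightarrow B :\equiv (A\to B)\wedge(B\to A)$); $\mathsf{IL}$ and $\mathsf{ML}$ are its intuitionistic and minimal counterparts. A function $N$ from formulas to formulas is a negative translation into $\mathsf{IL}$ (resp. $\mathsf{ML}$) if (soundness) for all formulas $A$ and all sets $\Gamma$ of possibly open formulas, $\mathsf{CL}+\Gamma\vdash A$ implies $\mathsf{IL}+N(\Gamma)\vdash N(A)$ (resp. $\mathsf{ML}+N(\Gamma)\vdash N(A)$), where $N(\Gamma)=\{N(B):B\in\Gamma\}$; and (characterisation) $\mathsf{CL}\vdash N(A)\leftrightarrow A$ for all formulas $A$. $A^G$ is the Gödel–Gentzen translation: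 $P^G :\equiv \neg\neg P$ for atomic $P \not\equiv \bot$; $\bot^G :\equiv \bot$; $(A\wedge B)^G :\equiv A^G\wedge B^G$; $(A\vee B)^G :\equiv \neg(\neg A^G\wedge\neg B^G)$; $(A\to B)^G :\equiv A^G\to B^G$; $(\forall xA)^G :\equiv \forall x A^G$; $(\exists xA)^G :\equiv \neg\forall x\neg A^G$. The negative fragment $\mathsf{NF}$ is inductively generated by: $\bot\in\mathsf{NF}$; $\neg P\in\mathsf{NF}$ for atomic $P$; if $A,B\in\mathsf{NF}$ then $A\wedge B, A\to B,\forall xA\in\mathsf{NF}$. *)

(* Defs.v *)
From mathcomp Require Import all_boot.
From mathcomp Require Import classical_sets.

Set Implicit Arguments.
Unset Strict Implicit.
Unset Printing Implicit Defensive.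

Local Open Scope classical_set_scope.

(* The language is an arbitrary one without equality; the purely relational
   language is the case where [fun_sym] is empty. *)
Record signature := Signature {
  fun_sym : Type;
  fun_ar : fun_sym -> nat;
  rel_sym : Type;
  rel_ar : rel_sym -> nat }.

Section Syntax.

Variable S : signature.

(* Variables are de Bruijn indices, so bound-variable variants of a formula are
   identified; an index pointing outside all binders is a free variable. *)
Inductive term : Type :=
  | Var of nat
  | App (f : fun_sym S) of {ffun 'I_(fun_ar f) -> term}.

Inductive form : Type :=
  | Rel (P : rel_sym S) of {ffun 'I_(rel_ar P) -> term}
  | Bot
  | And of form & form
  | Or of form & form
  | Imp of form & form
  | All of form
  | Ex of form.

Definition Neg (A : form) : form := Imp A Bot.
Definition Iff (A B : form) : form := And (Imp A B) (Imp B A).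

Fixpoint subst_term (s : nat -> term) (t : term) : term :=
  match t with
  | Var n => s n
  | App f ts => App [ffun i => subst_term s (ts i)]
  end.

Definition shift_term : term -> term := subst_term (fun n => Var n.+1).

Definition scons (t : term) (s : nat -> term) (n : nat) : term :=
  if n is m.+1 then s m else t.

Definition up (s : nat -> term) : nat -> term :=
  scons (Var 0) (fun n => shift_term (s n)).

Fixpoint subst (s : nat -> term) (A : form) : form :=
  match A with
  | Rel P ts => Rel [ffun i => subst_term s (ts i)]
  | Bot => Bot
  | And B C => And (subst s B) (subst s C)
  | Or B C => Or (subst s B) (subst s C)
  | Imp B C => Imp (subst s B) (subst s C)
  | All B => All (subst (up s) B)
  | Ex B => Ex (subst (up s) B)
  end.

Definition shift : form -> form := subst (fun n => Var n.+1).

(* The body [A] of a quantifier with its bound variable replaced by [t]. *)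
Definition inst (A : form) (t : term) : form := subst (scons t Var) A.

End Syntax.

Arguments Var {S} _.
Arguments Bot {S}.

Inductive logic := ML | IL | CL.

Definition has_efq (L : logic) : bool := if L is ML then false else true.
Definition has_raa (L : logic) : bool := if L is CL then true else false.

(* Natural deduction from a possibly infinite set of possibly open assumptions.
   The free variables of the assumptions are parameters: no generalisation over
   a variable free in an open assumption. The eigenvariable conditions of
   [d_AllI] and [d_ExE] are enforced by shifting the assumptions, which makes
   index 0 fresh for them. *)
Inductive derives (S : signature) (L : logic) :
    set (form S) -> form S -> Prop :=
  | d_Ax (G : set (form S)) A : G A -> derives L G A
  | d_AndI G A B : derives L G A -> derives L G B -> derives L G (And A B)
  | d_AndEl G A B : derives L G (And A B) -> derives L G A
  | d_AndEr G A B : derives L G (And A B) -> derives L G B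
  | d_OrIl G A B : derives L G A -> derives L G (Or A B)
  | d_OrIr G A B : derives L G B -> derives L G (Or A B)
  | d_OrE G A B C : derives L G (Or A B) ->
      derives L (A |` G) C -> derives L (B |` G) C -> derives L G C
  | d_ImpI G A B : derives L (A |` G) B -> derives L G (Imp A B)
  | d_ImpE G A B : derives L G (Imp A B) -> derives L G A -> derives L G B
  | d_AllI G A : derives L (@shift S @` G) A -> derives L G (All A)
  | d_AllE G A t : derives L G (All A) -> derives L G (inst A t)
  | d_ExI G A t : derives L G (inst A t) -> derives L G (Ex A)
  | d_ExE G A B : derives L G (Ex A) ->
      derives L (A |` (@shift S @` G)) (shift B) -> derives L G B
  | d_Efq G A : has_efq L -> derives L G Bot -> derives L G A
  | d_Raa G A : has_raa L -> derives L (Neg A |` G) Bot -> derives L G A.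

Definition provable (S : signature) (L : logic) (A : form S) : Prop :=
  derives L set0 A.

Definition soundness (S : signature) (L : logic) (N : form S -> form S) : Prop :=
  forall (G : set (form S)) (A : form S),
    derives CL G A -> derives L (N @` G) (N A).

Definition characterisation (S : signature) (N : form S -> form S) : Prop :=
  forall A : form S, provable CL (Iff (N A) A).

Definition negative_translation (S : signature) (L : logic)
    (N : form S -> form S) : Prop :=
  soundness L N /\ characterisation N.

Fixpoint godel_gentzen (S : signature) (A : form S) : form S :=
  match A with
  | Rel P ts => Neg (Neg (Rel ts))
  | Bot => Bot
  | And B C => And (godel_gentzen B) (godel_gentzen C)
  | Or B C => Neg (And (Neg (godel_gentzen B)) (Neg (godel_gentzen C)))
  | Imp B C => Imp (godel_gentzen B) (godel_gentzen C)
  | All B => All (godel_gentzen B)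
  | Ex B => Neg (All (Neg (godel_gentzen B)))
  end.

(* [Bot] counts as atomic. *)
Definition atomic (S : signature) (A : form S) : bool :=
  match A with Rel _ _ | Bot => true | _ => false end.

Inductive NF (S : signature) : form S -> Prop :=
  | NF_Bot : NF Bot
  | NF_NegAtom P : atomic P -> NF (Neg P)
  | NF_And A B : NF A -> NF B -> NF (And A B)
  | NF_Imp A B : NF A -> NF B -> NF (Imp A B)
  | NF_All A : NF A -> NF (All A).

Definition equivalent_to_GG (S : signature) (L : logic)
    (N : form S -> form S) : Prop :=
  forall A : form S, provable L (Iff (N A) (godel_gentzen A)).

Definition translates_into_NF (S : signature) (L : logic)
    (N : form S -> form S) : Prop :=
  forall A : form S, exists2 B : form S, NF B & provable L (Iff (N A) B).

Definition identity_on_NF (S : signature) (L : logic)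
    (N : form S -> form S) : Prop :=
  forall A : form S, NF A -> provable L (Iff (N A) A).

(* Main.v *)
(** Everything factors through the Gödel-Gentzen translation [G].  Formulas
    [A^G] are stable under double negation already in minimal logic, which makes
    [G] sound from classical into minimal logic; moreover [A^G] lies in the
    negative fragment, [G] is minimally the identity there, and [A <-> A^G]
    holds classically.
    (2) => (1): if [N A <-> B] with [B] negative, then [A <-> B] classically by
    the characterisation of [N], hence minimally [A^G <-> B^G <-> B <-> N A].
    (3) => (1): soundness of [N] applied to [A <-> A^G] gives
    [N A <-> N (A^G)], and [N (A^G) <-> A^G] since [A^G] is negative. *)
From mathcomp Require Import all_boot.
From mathcomp Require Import classical_sets.
Require Import Defs.

Set Implicit Arguments.
Unset Strict Implicit.
Unset Printing Implicit Defensive.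

Local Open Scope classical_set_scope.

Ltac hyp := apply: d_Ax; repeat (first [reflexivity | by left | right]).

(** * Renamings, their left inverses, and substitution in translated formulas *)

Section Substitution.

Variable S : signature.
Implicit Types (t : term S) (A : form S) (r s : nat -> term S).

(** The arguments of [App] sit inside a finite function, so the induction is written out by hand to
    get a hypothesis for each argument. *)
Lemma term_nested_ind (P : term S -> Prop) :
  (forall n, P (Var n)) ->
  (forall f (ts : {ffun 'I_(fun_ar f) -> term S}),
     (forall i, P (ts i)) -> P (App ts)) ->
  forall t, P t.
Proof.
move=> PV PA; fix IH 1 => -[n|f ts]; first exact: PV.
by apply: PA => i; apply: IH.
Qed.

(** Requiring each [r n] to be a variable makes [up] computable pointwise, so the relation passes
    under binders with no law for composing substitutions. *)
Definition renaming_retract r s : Prop :=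
  forall n, exists2 m, r n = Var m & s m = Var n.

Lemma renaming_retract_up r s :
  renaming_retract r s -> renaming_retract (up r) (up s).
Proof.
move=> rs [|n]; first by exists 0.
by have [m rn sm] := rs n; exists m.+1; rewrite /= /shift_term ?rn ?sm.
Qed.

Lemma subst_term_retract r s t :
  renaming_retract r s -> subst_term s (subst_term r t) = t.
Proof.
move=> rs; elim/term_nested_ind: t => [n|f ts IH] /=.
  by have [m -> /= ->] := rs n.
by congr App; apply/ffunP => i; rewrite !ffunE.
Qed.

Lemma subst_retract r s A :
  renaming_retract r s -> subst s (subst r A) = A.
Proof.
elim: A r s => [P ts||A IHA B IHB|A IHA B IHB|A IHA B IHB|A IHA|A IHA] r s rs //=.
- by congr Rel; apply/ffunP => i; rewrite !ffunE subst_term_retract.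
- by rewrite IHA ?IHB.
- by rewrite IHA ?IHB.
- by rewrite IHA ?IHB.
- by rewrite IHA //; apply: renaming_retract_up.
- by rewrite IHA //; apply: renaming_retract_up.
Qed.

Lemma inst_up_shift A :
  inst (subst (up (fun n => Var n.+1)) A) (Var 0) = A.
(* Index 0 is fixed throughout; index [n.+1] is raised to [n.+2] and lowered again by the
   instantiation. *)
Proof. by apply: subst_retract => -[|n]; [exists 0 | exists n.+2]. Qed.

Lemma godel_gentzen_subst s A :
  godel_gentzen (subst s A) = subst s (godel_gentzen A).
Proof.
by elim: A s => [P ts||A IHA B IHB|A IHA B IHB|A IHA B IHB|A IHA|A IHA] s //=;
  rewrite IHA ?IHB.
Qed.

End Substitution.

(** * Structural rules and congruence of provable equivalence *)

Section Derivations.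

Variables (S : signature) (L : logic).
Implicit Types (A B C : form S) (G H : set (form S)).

Lemma weaken G H A : G `<=` H -> derives L G A -> derives L H A.
Proof.
move=> GH D; elim: D H GH => {G A}.
- by move=> G A GA H GH; apply/d_Ax/GH.
- by move=> G A B _ IA _ IB H GH; apply: d_AndI; [apply: IA | apply: IB].
- by move=> G A B _ IH H GH; apply: d_AndEl (IH _ GH).
- by move=> G A B _ IH H GH; apply: d_AndEr (IH _ GH).
- by move=> G A B _ IH H GH; apply/d_OrIl/IH.
- by move=> G A B _ IH H GH; apply/d_OrIr/IH.
- move=> G A B C _ IH _ IA _ IB H GH; apply: d_OrE (IH _ GH) _ _.
  + exact/IA/setUS.
  + exact/IB/setUS.
- by move=> G A B _ IH H GH; apply/d_ImpI/IH/setUS.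
- by move=> G A B _ IA _ IB H GH; apply: d_ImpE (IA _ GH) (IB _ GH).
- by move=> G A _ IH H GH; apply/d_AllI/IH/image_subset.
- by move=> G A t _ IH H GH; apply/d_AllE/IH.
- by move=> G A t _ IH H GH; apply/d_ExI/IH.
- move=> G A B _ IA _ IB H GH; apply: d_ExE (IA _ GH) _.
  exact/IB/setUS/image_subset.
- by move=> G A efq _ IH H GH; apply/d_Efq/IH.
- by move=> G A raa _ IH H GH; apply/d_Raa/IH/setUS.
Qed.

Lemma cut G A B : derives L [set A] B -> derives L G A -> derives L G B.
Proof.
move=> AB; apply: d_ImpE; apply: d_ImpI; apply: weaken AB.
by move=> C ->; left.
Qed.

Lemma provable_IffP A B :
  provable L (Iff A B) <-> derives L [set A] B /\ derives L [set B] A.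
Proof.
split=> [AB|[AB BA]]; last first.
  by apply: d_AndI; apply: d_ImpI; rewrite setU0.
split; (apply: d_ImpE; last by hyp);
  [apply: d_AndEl|apply: d_AndEr]; exact: weaken AB.
Qed.

Lemma Iff_refl A : provable L (Iff A A).
Proof. by apply/provable_IffP; split; hyp. Qed.

Lemma Iff_sym A B : provable L (Iff A B) -> provable L (Iff B A).
Proof. by move=> /provable_IffP[AB BA]; apply/provable_IffP. Qed.

Lemma Iff_trans A B C :
  provable L (Iff A B) -> provable L (Iff B C) -> provable L (Iff A C).
Proof.
move=> /provable_IffP[AB BA] /provable_IffP[BC CB].
by apply/provable_IffP; split; [apply: cut BC AB | apply: cut BA CB].
Qed.

Lemma Iff_And A A' B B' : provable L (Iff A A') -> provable L (Iff B B') ->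
  provable L (Iff (And A B) (And A' B')).
Proof.
move=> /provable_IffP[AA' A'A] /provable_IffP[BB' B'B].
apply/provable_IffP; split; apply: d_AndI.
- by apply: cut AA' _; apply: d_AndEl; hyp.
- by apply: cut BB' _; apply: d_AndEr; hyp.
- by apply: cut A'A _; apply: d_AndEl; hyp.
- by apply: cut B'B _; apply: d_AndEr; hyp.
Qed.

Lemma Iff_Imp A A' B B' : provable L (Iff A A') -> provable L (Iff B B') ->
  provable L (Iff (Imp A B) (Imp A' B')).
Proof.
move=> /provable_IffP[AA' A'A] /provable_IffP[BB' B'B].
apply/provable_IffP; split; apply: d_ImpI.
- by apply: cut BB' _; apply: d_ImpE; [hyp | apply: cut A'A _; hyp].
- by apply: cut B'B _; apply: d_ImpE; [hyp | apply: cut AA' _; hyp].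
Qed.

Lemma Iff_Neg A A' : provable L (Iff A A') -> provable L (Iff (Neg A) (Neg A')).
Proof. by move=> AA'; apply: Iff_Imp AA' (Iff_refl _). Qed.

(* The eigenvariable itself, [Var 0], is the instantiating term. *)
Lemma derives_shift_All G A : derives L G (shift (All A)) -> derives L G A.
Proof. by move=> /(d_AllE (Var 0)); rewrite inst_up_shift. Qed.

Lemma derives_shift_Ex G A : derives L G A -> derives L G (shift (Ex A)).
Proof. by move=> GA; apply: (d_ExI (t := Var 0)); rewrite inst_up_shift. Qed.

(** Index 0 may be free in the assumption [A], which blocks generalising the given entailment
    directly. Instead the goal is opened with index 0 fresh for [All A], which is instantiated there
    before cutting. *)
Lemma All_mono A B : derives L [set A] B -> derives L [set All A] (All B).
Proof.
move=> AB; apply: d_AllI; apply: cut AB _; apply: derives_shift_All.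
by apply: d_Ax; exists (All A).
Qed.

Lemma Iff_All A A' : provable L (Iff A A') -> provable L (Iff (All A) (All A')).
Proof.
by move=> /provable_IffP[AA' A'A]; apply/provable_IffP; split; apply: All_mono.
Qed.

(** * Stability and soundness of the Gödel-Gentzen translation, and the negative fragment *)

Lemma triple_neg A : derives L [set Neg (Neg (Neg A))] (Neg A).
Proof.
apply: d_ImpI; apply: (d_ImpE (A := Neg (Neg A))); first by hyp.
by apply: d_ImpI; apply: (d_ImpE (A := A)); hyp.
Qed.

Lemma neg_stableP G A : derives L [set Neg (Neg A)] A ->
  derives L (Neg A |` G) Bot -> derives L G A.
Proof. by move=> st D; apply: cut st _; apply: d_ImpI. Qed.

(** Relational atoms, disjunctions and existentials translate to negations, stable because three
    negations collapse to one. Conjunctions and universals inherit stability from their components,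
    implications from their conclusion. *)
Lemma godel_gentzen_stable A :
  derives L [set Neg (Neg (godel_gentzen A))] (godel_gentzen A).
Proof.
elim: A => [P ts||A IHA B IHB|A _ B _|A _ B IHB|A IHA|A _] /=;
  try exact: triple_neg.
- apply: (d_ImpE (A := Neg Bot)); first by hyp.
  by apply: d_ImpI; hyp.
- apply: d_AndI.
  + apply: neg_stableP IHA _.
    apply: (d_ImpE (A := Neg (And (godel_gentzen A) (godel_gentzen B))));
      first by hyp.
    apply: d_ImpI; apply: (d_ImpE (A := godel_gentzen A)); first by hyp.
    by apply: d_AndEl; hyp.
  + apply: neg_stableP IHB _.
    apply: (d_ImpE (A := Neg (And (godel_gentzen A) (godel_gentzen B))));
      first by hyp.
    apply: d_ImpI; apply: (d_ImpE (A := godel_gentzen B)); first by hyp.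
    by apply: d_AndEr; hyp.
- apply: d_ImpI; apply: neg_stableP IHB _.
  apply: (d_ImpE (A := Neg (Imp (godel_gentzen A) (godel_gentzen B))));
    first by hyp.
  apply: d_ImpI; apply: (d_ImpE (A := godel_gentzen B)); first by hyp.
  by apply: (d_ImpE (A := godel_gentzen A)); hyp.
- apply: d_AllI; apply: neg_stableP IHA _.
  apply: (d_ImpE (A := shift (Neg (All (godel_gentzen A))))).
    (* [shift] commutes with [Neg] by computation, so the shifted assumption is already the negation
       required. *)
    by apply: d_Ax; right; exists (Neg (Neg (All (godel_gentzen A)))).
  apply: d_ImpI; apply: (d_ImpE (A := godel_gentzen A)); first by hyp.
  by apply: derives_shift_All; hyp.
Qed.

Lemma godel_gentzen_raa G A :
  derives L (Neg (godel_gentzen A) |` G) Bot -> derives L G (godel_gentzen A).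
Proof. exact/neg_stableP/godel_gentzen_stable. Qed.

Lemma godel_gentzen_image_shift G :
  @godel_gentzen S @` (@shift S @` G) = @shift S @` (@godel_gentzen S @` G).
Proof.
rewrite !image_comp; apply: eq_imagel => A _ /=.
exact: godel_gentzen_subst.
Qed.

(** Induction on the classical derivation. Eliminations of [Or] and [Ex], ex falso and reductio all
    refute the negated translated conclusion, which its stability permits without any classical rule
    in [L]. *)
Lemma godel_gentzen_sound : soundness L (@godel_gentzen S).
Proof.
move=> G A D; elim: D => {G A} /=.
- by move=> G A GA; apply: d_Ax; exists A.
- by move=> G A B _ IA _ IB; apply: d_AndI.
- by move=> G A B _ IH; apply: d_AndEl IH.
- by move=> G A B _ IH; apply: d_AndEr IH.
- move=> G A B _ IH; apply: d_ImpI; apply: (d_ImpE (A := godel_gentzen A)).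
    by apply: d_AndEl; hyp.
  by apply: weaken IH => ? ?; right.
- move=> G A B _ IH; apply: d_ImpI; apply: (d_ImpE (A := godel_gentzen B)).
    by apply: d_AndEr; hyp.
  by apply: weaken IH => ? ?; right.
- move=> G A B C _ IH _ + _; rewrite !image_setU !image_set1 => IA IB.
  (* Once the translation of [C] is assumed refuted, each branch refutes its own disjunct,
     contradicting the translated disjunction. *)
  apply: godel_gentzen_raa.
  apply: d_ImpE; first by apply: weaken IH => ? ?; right.
  apply: d_AndI; apply: d_ImpI; (apply: (d_ImpE (A := godel_gentzen C));
    first by hyp).
  + by apply: weaken IA; apply: setUS => ? ?; right.
  + by apply: weaken IB; apply: setUS => ? ?; right.
- by move=> G A B _; rewrite image_setU image_set1 => IH; apply: d_ImpI.
- by move=> G A B _ IA _ IB; apply: d_ImpE IA IB.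
- by move=> G A _; rewrite godel_gentzen_image_shift => IH; apply: d_AllI.
- by move=> G A t _ IH; rewrite godel_gentzen_subst; apply: d_AllE.
- move=> G A t _ IH; apply: d_ImpI.
  apply: (d_ImpE (A := inst (godel_gentzen A) t)).
    by apply: (d_AllE (A := Neg (godel_gentzen A))); hyp.
  by rewrite /inst -godel_gentzen_subst; apply: weaken IH => ? ?; right.
- move=> G A B _ IA _; rewrite image_setU image_set1 godel_gentzen_image_shift.
  rewrite godel_gentzen_subst => IB.
  (* The same argument with a fresh witness: the refuted conclusion refutes every instance of the
     body. *)
  apply: godel_gentzen_raa.
  apply: d_ImpE; first by apply: weaken IA => ? ?; right.
  apply: d_AllI; apply: d_ImpI.
  apply: (d_ImpE (A := shift (godel_gentzen B))).
    by apply: d_Ax; right; exists (Neg (godel_gentzen B)); [left|].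
  apply: weaken IB; apply/setUS/image_subset => ? ?; by right.
- move=> G A _ _ IH; apply: godel_gentzen_raa.
  by apply: weaken IH => ? ?; right.
- move=> G A _ _; rewrite image_setU image_set1 => IH.
  exact: godel_gentzen_raa.
Qed.

(** The fragment is closed under [Neg], an implication into [Bot]; a doubly negated atom is the
    negation of a generator. *)
Lemma godel_gentzen_NF A : NF (godel_gentzen A).
Proof.
elim: A => [P ts||A IHA B IHB|A IHA B IHB|A IHA B IHB|A IHA|A IHA] /=;
  by repeat (assumption || (by apply: NF_NegAtom) || constructor).
Qed.

(** Within the fragment the translation changes only relational atoms, and these occur negated,
    where the resulting triple negation collapses. *)
Lemma godel_gentzen_id_NF : identity_on_NF L (@godel_gentzen S).
Proof.
move=> A; elim=> {A} /=.
- exact: Iff_refl.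
- case=> //= [P ts|] _; last exact: Iff_refl.
  apply/provable_IffP; split; first exact: triple_neg.
  by apply: d_ImpI; apply: (d_ImpE (A := Neg (Rel ts))); hyp.
- by move=> A B _ IA _ IB; apply: Iff_And.
- by move=> A B _ IA _ IB; apply: Iff_Imp.
- by move=> A _ IA; apply: Iff_All.
Qed.

Lemma derives_CL G A : derives L G A -> derives CL G A.
Proof.
elim=> {G A}.
- by move=> G A GA; apply: d_Ax.
- by move=> G A B _ IA _ IB; apply: d_AndI.
- by move=> G A B _ IH; apply: d_AndEl IH.
- by move=> G A B _ IH; apply: d_AndEr IH.
- by move=> G A B _ IH; apply: d_OrIl.
- by move=> G A B _ IH; apply: d_OrIr.
- by move=> G A B C _ IH _ IA _ IB; apply: d_OrE IH IA IB.
- by move=> G A B _ IH; apply: d_ImpI.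
- by move=> G A B _ IA _ IB; apply: d_ImpE IA IB.
- by move=> G A _ IH; apply: d_AllI.
- by move=> G A t _ IH; apply: d_AllE.
- by move=> G A t _ IH; apply: d_ExI IH.
- by move=> G A B _ IA _ IB; apply: d_ExE IA IB.
- by move=> G A _ _ IH; apply: d_Efq.
- by move=> G A _ _ IH; apply: d_Raa.
Qed.

End Derivations.

(** * Classical equivalence of a formula with its translation *)

Section Classical.

Variable S : signature.
Implicit Types A B : form S.

Lemma Or_deMorgan A B : provable CL (Iff (Neg (And (Neg A) (Neg B))) (Or A B)).
Proof.
apply/provable_IffP; split.
- apply: d_Raa => //; apply: (d_ImpE (A := And (Neg A) (Neg B))); first by hyp.
  apply: d_AndI; apply: d_ImpI; (apply: (d_ImpE (A := Or A B)); first by hyp).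
  + by apply: d_OrIl; hyp.
  + by apply: d_OrIr; hyp.
- apply: d_ImpI; apply: (d_OrE (A := A) (B := B)); first by hyp.
  + by apply: (d_ImpE (A := A)); [apply: d_AndEl; hyp | hyp].
  + by apply: (d_ImpE (A := B)); [apply: d_AndEr; hyp | hyp].
Qed.

Lemma Ex_deMorgan A : provable CL (Iff (Neg (All (Neg A))) (Ex A)).
Proof.
apply/provable_IffP; split.
- apply: d_Raa => //; apply: (d_ImpE (A := All (Neg A))); first by hyp.
  apply: d_AllI; apply: d_ImpI; apply: (d_ImpE (A := shift (Ex A))).
    by apply: d_Ax; right; exists (Neg (Ex A)); [left|].
  by apply: derives_shift_Ex; hyp.
- apply: (d_ExE (A := A)); first by hyp.
  apply: d_ImpI; apply: (d_ImpE (A := A)); last by hyp.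
  by apply: (derives_shift_All (A := Neg A)); hyp.
Qed.

Lemma godel_gentzen_characterisation : characterisation (@godel_gentzen S).
Proof.
elim=> [P ts||A IHA B IHB|A IHA B IHB|A IHA B IHB|A IHA|A IHA] /=.
- apply/provable_IffP; split.
    apply: d_Raa => //.
    by apply: (d_ImpE (A := Neg (Rel ts))); hyp.
  by apply: d_ImpI; apply: (d_ImpE (A := Rel ts)); hyp.
- exact: Iff_refl.
- exact: Iff_And.
- by apply: Iff_trans (Or_deMorgan A B); apply/Iff_Neg/Iff_And; apply: Iff_Neg.
- exact: Iff_Imp.
- exact: Iff_All.
- by apply: Iff_trans (Ex_deMorgan A); apply/Iff_Neg/Iff_All/Iff_Neg.
Qed.

End Classical.

(** An arbitrary [N] need not commute with [Iff], so soundness is applied to the two entailments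
    from singleton contexts rather than to the equivalence itself. *)
Lemma sound_Iff (S : signature) (L : logic) (N : form S -> form S) A B :
  soundness L N -> provable CL (Iff A B) -> provable L (Iff (N A) (N B)).
Proof.
move=> sN /provable_IffP[/sN + /sN]; rewrite !image_set1 => AB BA.
exact/provable_IffP.
Qed.

(** * Comparison of an arbitrary negative translation with Gödel-Gentzen *)

Section Equivalence.

Variables (S : signature) (L : logic) (N : form S -> form S).

Lemma GG_translates_into_NF : equivalent_to_GG L N -> translates_into_NF L N.
Proof.
by move=> NG A; exists (godel_gentzen A); [apply: godel_gentzen_NF|].
Qed.

Lemma GG_identity_on_NF : equivalent_to_GG L N -> identity_on_NF L N.
Proof.
by move=> NG A nfA; apply: Iff_trans (NG A) (godel_gentzen_id_NF L nfA).
Qed.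

Lemma translates_into_NF_GG :
  characterisation N -> translates_into_NF L N -> equivalent_to_GG L N.
Proof.
move=> cN tN A; have [B nfB NAB] := tN A.
have AB : provable CL (Iff A B).
  exact: Iff_trans (Iff_sym (cN A)) (derives_CL NAB).
apply: Iff_trans NAB (Iff_sym _).
exact: Iff_trans (sound_Iff (@godel_gentzen_sound S L) AB) (godel_gentzen_id_NF L nfB).
Qed.

Lemma identity_on_NF_GG :
  soundness L N -> identity_on_NF L N -> equivalent_to_GG L N.
Proof.
move=> sN idN A; apply: Iff_trans (idN _ (godel_gentzen_NF A)).
exact/(sound_Iff sN)/Iff_sym/godel_gentzen_characterisation.
Qed.

Lemma negative_translation_tfae : negative_translation L N ->
  (equivalent_to_GG L N <-> translates_into_NF L N) /\
  (translates_into_NF L N <-> identity_on_NF L N).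
Proof.
case=> sN cN; split; split.
- exact: GG_translates_into_NF.
- exact: translates_into_NF_GG.
- by move=> /(translates_into_NF_GG cN); apply: GG_identity_on_NF.
- by move=> /(identity_on_NF_GG sN); apply: GG_translates_into_NF.
Qed.

End Equivalence.

Theorem theorem2 (S : signature) :
  (forall N : form S -> form S, negative_translation IL N ->
     (equivalent_to_GG IL N <-> translates_into_NF IL N) /\
     (translates_into_NF IL N <-> identity_on_NF IL N)) /\
  (forall N : form S -> form S, negative_translation ML N ->
     (equivalent_to_GG ML N <-> translates_into_NF ML N) /\
     (translates_into_NF ML N <-> identity_on_NF ML N)).
Proof. by split=> N; apply: negative_translation_tfae. Qed.
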